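(* Let $v\in\mathcal M$. Then $v\in V_{\mathrm{geo}}$ if and only if $\hat\phi_{\mathrm{geo}}(v)=0$.
   Context: Let $x_k,y_k,w_k$ ($k\in\mathbb N=\{0,1,\dots\}$) be commuting variables. For a monomial $m=\prod_kx_k^{a_k}\prod_ky_k^{b_k}\prod_kw_k^{c_k}$ put $((m))=\sum_ka_k$ and $[m]=\sum_k(1-k)a_k-\sum_k(1+k)b_k+\sum_k(1-k)c_k$. Let $\mathcal M$ be the real linear span of the monomials $m$ in the variables $x_k,y_k$ only with $[m]=1$ and $((m))\ge2$. For smooth $\Gamma,\sigma:\mathbb R\to\mathbb R$, $\Upsilon_{\Gamma,\sigma}:\mathcal M\to\mathcal C^\infty(\mathbb R,\mathbb R)$ is the linear map with $\Upsilon_{\Gamma,\sigma}(m)(u)=\prod_k(\sigma^{(k)}(u))^{a_k}\prod_k(2\Gamma^{(k)}(u))^{b_k}$. For a diffeomorphism $\varphi:\mathbb R\to\mathbb R$ and smooth $f,\Gamma$, define $\varphi\cdot f$ by $(\varphi\cdot f)(\varphi(u))=\varphi'(u)f(u)$ (applied to $f=\sigma$ and to $f=\Upsilon_{\Gamma,\sigma}(v)$), and define $\varphi\cdot\Gamma$ by $(\varphi\cdot\Gamma)(\varphi(u))(\varphi'(u))^2=\varphi'(u)\Gamma(u)-\varphi''(u)$. $V_{\mathrm{geo}}\subset\mathcal M$ is the subspace of all $v$ such that $\varphi\cdot\Upsilon_{\Gamma,\sigma}(v)=\Upsilon_{\varphi\cdot\Gamma,\varphi\cdot\sigma}(v)$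 for all smooth $\Gamma,\sigma$ and all diffeomorphisms $\varphi$ of $\mathbb R$ homotopic to the identity. On $\mathbb R[x_k,y_k,w_k:k\ge0]$ let $D$ be the derivation with $Dx_k=x_{k+1}$, $Dy_k=y_{k+1}$, $Dw_k=w_{k+1}$, and $[v_1,v_2]=v_1Dv_2-v_2Dv_1$. Let $\phi_{\mathrm{geo}}$ be the linear map from $\mathbb R[x_k,y_k:k\ge 0]$ to $\mathbb R[x_k,y_k,w_k:k\ge 0]$ satisfying the Leibniz rule with $$\phi_{\mathrm{geo}}(x_k)=D^k[x_0,w_0],\qquad \phi_{\mathrm{geo}}(y_k)=-D^{k+1}(y_0w_0)-2w_{k+2},$$ and set $\hat\phi_{\mathrm{geo}}(v)=\phi_{\mathrm{geo}}(v)-[v,w_0]$ for $v\in\mathcal M$. *)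

(* Defs.v *)
From HB Require Import structures.
From mathcomp Require Import all_boot all_order all_algebra.
(* monalg must precede the analysis files: their notations clash in the other
   order. *)
From mathcomp Require Import finmap monalg ring.
From mathcomp Require Import boolp classical_sets functions reals.
From mathcomp Require Import topology normedtype derive realfun.

Set Implicit Arguments.
Unset Strict Implicit.
Unset Printing Implicit Defensive.

Import Order.TTheory GRing.Theory Num.Theory.
Import numFieldTopology.Exports numFieldNormedType.Exports.

Local Open Scope ring_scope.

Section Derivation.
Variables (I : choiceType) (R : comNzRingType).
Local Notation poly := {malg R[{cmonom I}]}.
Implicit Types (p q : poly) (m : {cmonom I}) (i : I).

Definition mvar i : poly := << ucm i >>.

Lemma malgUM (a b : R) m1 m2 :
  << a *g m1 >> * << b *g m2 >> = << a * b *g mmul m1 m2 >> :> poly.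
Proof. by rewrite malgM_def fgmulUU. Qed.

Lemma malgZU (a b : R) m : a *: << b *g m >> = << a * b *g m >> :> poly.
Proof. by rewrite -mul_malgC malgUM mul1m. Qed.

Variable d : I -> poly.

Definition derivm m : poly :=
  \sum_(i <- finsupp m) << (m i)%:R *g divcm m (ucm i) >> * d i.

(* The derivation with prescribed values d on the variables, cf. deriv_var,
   derivD, derivZ and derivM below. *)
Definition deriv p : poly := \sum_(m <- msupp p) p@_m *: derivm m.

Lemma derivE p : deriv p = mmap (@malgC _ R) derivm p.
Proof.
by rewrite mmapE; apply: eq_bigr => m _; rewrite mul_malgC.
Qed.

Lemma derivD p q : deriv (p + q) = deriv p + deriv q.
Proof. by rewrite !derivE mmapD. Qed.

Lemma deriv_sum (J : Type) (s : seq J) (F : J -> poly) :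
  deriv (\sum_(j <- s) F j) = \sum_(j <- s) deriv (F j).
Proof.
by rewrite derivE raddf_sum; apply: eq_bigr => j _; rewrite derivE.
Qed.

Lemma derivU (c : R) m : deriv << c *g m >> = c *: derivm m.
Proof. by rewrite derivE mmapU mul_malgC. Qed.

Lemma derivZ (c : R) p : deriv (c *: p) = c *: deriv p.
Proof.
rewrite [in LHS](monalgE p) scaler_sumr deriv_sum scaler_sumr.
apply: eq_bigr => m _; rewrite malgZU !derivU scalerA.
by [].
Qed.

Let derivmw (E : {fset I}) m : (finsupp m `<=` E)%fset ->
  derivm m = \sum_(i <- E) << (m i)%:R *g divcm m (ucm i) >> * d i.
Proof.
move=> mE; rewrite /derivm (big_fset_incl _ mE) // => i _.
by rewrite -cmE_eq0 => /eqP ->; rewrite monalgU0 mul0r.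
Qed.

Let divcmM m m' i n : m i = n.+1 ->
  divcm (mmul m m') (ucm i) = mmul (divcm m (ucm i)) m'.
Proof.
move=> mi; apply/eqP/cmP => j.
rewrite cmM !divcmE ucmE cmM.
by case: eqVneq => [<-|_]; rewrite ?mi ?subn0 // !subn1.
Qed.

Let sum_leibniz (E : seq I) (F G H : I -> poly) (a b : poly) :
  (forall i, F i = G i * a + b * H i) ->
  \sum_(i <- E) F i = (\sum_(i <- E) G i) * a + b * \sum_(i <- E) H i.
Proof.
by move=> FE; rewrite mulr_suml mulr_sumr -big_split; apply: eq_bigr.
Qed.

Lemma derivmM m1 m2 : derivm (mmul m1 m2)
  = derivm m1 * << m2 >> + << m1 >> * derivm m2.
Proof.
set E := (finsupp m1 `|` finsupp m2)%fset.
rewrite (derivmw (E := E)) ?mdomD ?fsubset_refl //.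
rewrite (derivmw (fsubsetUl _ _ : _ `<=` E)%fset).
rewrite (derivmw (fsubsetUr _ _ : _ `<=` E)%fset).
have dvdU i (m m' : {cmonom I}) :
    << (m i)%:R *g divcm (mmul m m') (ucm i) >>
    = << (m i)%:R *g divcm m (ucm i) >> * << m' >> :> poly.
  rewrite malgUM mulr1; case mi : (m i) => [|n]; first by rewrite !monalgU0.
  by rewrite (divcmM _ mi).
apply: sum_leibniz => i.
rewrite cmM natrD monalgUD mulrDl dvdU mulmC dvdU.
move: << _ *g divcm m1 _ >> << _ *g divcm m2 _ >> << m1 >> << m2 >> (d i).
by move=> a b u1 u2 z; ring.
Qed.

Let deriv0 : deriv 0 = 0.
Proof. by rewrite derivE mmap0. Qed.

Lemma derivM p q : deriv (p * q) = deriv p * q + p * deriv q.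
Proof.
have mulU (c : R) m : << c *g m >> = c%:MP * << m >> :> poly.
  by rewrite mul_malgC malgZU mulr1.
have UM c m c' m' : deriv (<< c *g m >> * << c' *g m' >>) =
    deriv << c *g m >> * << c' *g m' >> + << c *g m >> * deriv << c' *g m' >>.
  have aux (a a' e e' u u' v v' dv dv' : poly) :
      v = a * u -> v' = a' * u' -> dv = a * e -> dv' = a' * e' ->
    (a * a') * (e * u' + u * e') = dv * v' + v * dv'.
    by move=> -> -> -> ->; ring.
  apply: etrans (congr1 deriv (malgUM c c' m m')) _.
  apply: etrans (derivU (c * c') (mmul m m')) _.
  apply: etrans (congr1 _ (derivmM m m')) _.
  apply: etrans (esym (mul_malgC (c * c') _)) _.
  apply: etrans (congr1 (fun z => z * _) (mpolyCM _ c c')) _.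
  apply: aux (mulU c m) (mulU c' m') _ _.
    exact: etrans (derivU c m) (esym (mul_malgC c _)).
  exact: etrans (derivU c' m') (esym (mul_malgC c' _)).
have Uq c m : deriv (<< c *g m >> * q) =
    deriv << c *g m >> * q + << c *g m >> * deriv q.
  rewrite [q]monalgE; elim: (enum_fset (msupp q)) => [|m' s IHs].
    by rewrite !big_nil deriv0 !mulr0 deriv0 addr0.
  rewrite !big_cons; move: IHs (UM c m q@_m' m').
  move: << c *g m >> << _ *g m' >> => u u'.
  move: (\sum_(_ <- s) _) => u'' IHs UM'.
  have aux (du dv dw z z1 z2 : poly) : z1 = du * u' + u * dv ->
      z2 = du * u'' + u * dw -> z = dv + dw ->
      z1 + z2 = du * (u' + u'') + u * z.
    by move=> -> -> ->; ring.
  apply: etrans (congr1 deriv (mulrDr u u' u'')) _.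
  apply: etrans (derivD _ _) _.
  exact: aux UM' IHs (derivD u' u'').
rewrite [p]monalgE; elim: (enum_fset (msupp p)) => [|m s IHs].
  by rewrite !big_nil deriv0 !mul0r deriv0 addr0.
rewrite !big_cons; move: IHs (Uq p@_m m).
move: << _ *g m >> (\sum_(_ <- s) _) => u u' IHs Uq'.
have aux (dq du dv z z1 z2 : poly) : z1 = du * q + u * dq ->
    z2 = dv * q + u' * dq -> z = du + dv ->
    z1 + z2 = z * q + (u + u') * dq.
  by move=> -> -> ->; ring.
apply: etrans (congr1 deriv (mulrDl u u' q)) _.
apply: etrans (derivD _ _) _.
exact: aux Uq' IHs (derivD u u').
Qed.

Lemma deriv_var i : deriv (mvar i) = d i.
Proof.
rewrite derivU scale1r /derivm mdomU big_seq_fset1 cmUU.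
have -> : divcm (ucm i) (ucm i) = mone.
  by apply/eqP/cmP => j; rewrite divcmE cm1 subnn.
exact: etrans (congr1 (fun z => z * d i) (mpolyC1E _ _)) (mul1r _).
Qed.

End Derivation.

Inductive var := X of nat | Y of nat | W of nat.

Definition var_code (i : var) : nat + nat + nat :=
  match i with X k => inl (inl k) | Y k => inl (inr k) | W k => inr k end.
Definition var_decode (c : nat + nat + nat) : var :=
  match c with inl (inl k) => X k | inl (inr k) => Y k | inr k => W k end.

Lemma var_codeK : cancel var_code var_decode.
Proof. by case. Qed.

HB.instance Definition _ := Countable.copy var (can_type var_codeK).

(* R[x_k, y_k, w_k : k >= 0]; R[x_k, y_k : k >= 0] is viewed as a subring. *)
Notation dpoly R := {malg R[{cmonom var}]}.

(* The contribution of one factor to [m]. *)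
Definition weight (i : var) : int :=
  match i with
  | X k => 1 - k%:Z
  | Y k => - (1 + k%:Z)
  | W k => 1 - k%:Z
  end.

Definition is_X (i : var) : bool := if i is X _ then true else false.
Definition is_W (i : var) : bool := if i is W _ then true else false.

(* ((m)) *)
Definition xdeg (m : {cmonom var}) : nat :=
  (\sum_(i <- finsupp m | is_X i) m i)%N.

(* [m] *)
Definition mweight (m : {cmonom var}) : int :=
  \sum_(i <- finsupp m) (m i)%:Z * weight i.

Definition monomM (m : {cmonom var}) : bool :=
  [&& all (fun i => ~~ is_W i) (finsupp m), mweight m == 1 & (2 <= xdeg m)%N].

Section Algebra.
Variable R : comNzRingType.
Implicit Types (v p q : dpoly R) (m : {cmonom var}) (i : var).

Definition calM v : Prop :=
  exists (s : seq {cmonom var}) (c : {cmonom var} -> R),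
    all monomM s /\ v = \sum_(m <- s) c m *: << m >>.

Definition x_ k : dpoly R := mvar R (X k).
Definition y_ k : dpoly R := mvar R (Y k).
Definition w_ k : dpoly R := mvar R (W k).

Definition D : dpoly R -> dpoly R :=
  deriv (fun i => match i with
                  | X k => x_ k.+1 | Y k => y_ k.+1 | W k => w_ k.+1 end).

Definition bracket v1 v2 := v1 * D v2 - v2 * D v1.

(* Only used on R[x, y], so its value 0 on the variables w_k is immaterial. *)
Definition phi_geo : dpoly R -> dpoly R :=
  deriv (fun i => match i with
                  | X k => iter k D (bracket (x_ 0) (w_ 0))
                  | Y k => - iter k.+1 D (y_ 0 * w_ 0) - 2 * w_ k.+2
                  | W k => 0
                  end).

Definition phi_geo_hat v := phi_geo v - bracket v (w_ 0).

End Algebra.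

Section Geometry.
Variable R : realType.
Implicit Types f g Gamma sigma : R -> R.

Local Open Scope classical_set_scope.

Definition smooth f : Prop := forall n (u : R), derivable (derive1n n f) u 1.

Record diffeo := Diffeo {
  dfun :> R -> R;
  dinv : R -> R;
  dfun_smooth : smooth dfun;
  dinv_smooth : smooth dinv;
  dfunK : cancel dfun dinv;
  dinvK : cancel dinv dfun
}.

Arguments dfun_smooth : clear implicits.
Arguments dinv_smooth : clear implicits.

Definition homotopic f g : Prop :=
  exists H : R * R -> R,
    [/\ {within [set p : R * R | 0 <= p.1 <= 1], continuous H},
        forall u, H (0, u) = f u &
        forall u, H (1, u) = g u].

(* On monomials without w_k, the only ones where Upsilon is used, the value at
   W k plays no role. *)
Definition jet Gamma sigma (u : R) (i : var) : R :=
  match i with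
  | X k => derive1n k sigma u
  | Y k => 2 * derive1n k Gamma u
  | W k => 1
  end.

Definition Upsilon Gamma sigma (v : dpoly R) : R -> R := fun u =>
  \sum_(m <- msupp v) v@_m * \prod_(i <- finsupp m) jet Gamma sigma u i ^+ m i.

(* The defining equations at phi u are act_vecE and act_christE. *)
Definition act_vec (phi : diffeo) f : R -> R := fun z =>
  let u := dinv phi z in derive1 phi u * f u.

Definition act_christ (phi : diffeo) Gamma : R -> R := fun z =>
  let u := dinv phi z in
  (derive1 phi u * Gamma u - derive1n 2 phi u) / derive1 phi u ^+ 2.

Lemma derive_diffeo_neq0 (phi : diffeo) u : derive1 phi u != 0.
Proof.
have df t : derivable phi t 1 by exact: (dfun_smooth phi 0 t).
have dg t : derivable (dinv phi) t 1 by exact: (dinv_smooth phi 0 t).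
have : derive1 (dinv phi \o phi) u = 1.
  rewrite (_ : _ \o _ = id) ?derive1_id //; first by apply/funext/dfunK.
rewrite derive1_comp // => h; apply/eqP => h0.
by move: h; rewrite h0 mulr0 => /esym/eqP; rewrite oner_eq0.
Qed.

Lemma act_vecE (phi : diffeo) f u :
  act_vec phi f (phi u) = derive1 phi u * f u.
Proof. by rewrite /act_vec dfunK. Qed.

Lemma act_christE (phi : diffeo) Gamma u :
  act_christ phi Gamma (phi u) * derive1 phi u ^+ 2
  = derive1 phi u * Gamma u - derive1n 2 phi u.
Proof.
by rewrite /act_christ dfunK divfK // expf_neq0 ?derive_diffeo_neq0.
Qed.

Definition Vgeo (v : dpoly R) : Prop :=
  calM v /\
  forall (phi : diffeo) Gamma sigma,
    homotopic phi id -> smooth Gamma -> smooth sigma ->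
    act_vec phi (Upsilon Gamma sigma v)
    = Upsilon (act_christ phi Gamma) (act_vec phi sigma) v.

End Geometry.

(* Main.v *)
Require Import Defs.
From HB Require Import structures.
From mathcomp Require Import all_boot all_order all_algebra.
From mathcomp Require Import finmap monalg ring lra.
From mathcomp Require Import boolp classical_sets functions reals interval_inference.
From mathcomp Require Import topology normedtype derive realfun trigo.

Set Implicit Arguments.
Unset Strict Implicit.
Unset Printing Implicit Defensive.

Import Order.TTheory GRing.Theory Num.Theory.
Import numFieldTopology.Exports numFieldNormedType.Exports.

Local Open Scope classical_set_scope.
Local Open Scope ring_scope.

Import Defs.

(** Fix smooth [sigma], [Gamma], [eta] and consider the straight path of maps
phi_t (u) = s u + t eta (u), which are diffeomorphisms as long as the slope
s + t eta' does not vanish. Let c_t be the valuation of the variables x_k,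
y_k, w_k by the k-th derivatives, at the moving point phi_t (u), of
phi_t.sigma, of 2 phi_t.Gamma, and of the velocity field of the path, which is
eta transported by phi_t. Then Upsilon (v) for the transported pair, taken at
phi_t (u), is the value v (c_t) of the polynomial v, and v is covariant along
the path when v (c_t) is proportional to the slope phi_t' (u).

The point is that c_t solves a polynomial differential equation: the time
derivative of its coordinate x_k, or y_k, is the value at c_t of
phi_geo (x_k) + w_0 D x_k, resp. phi_geo (y_k) + w_0 D y_k ([curve_drift]).
Here phi_geo is the variation of the transported objects at a fixed point of
the line, and w_0 D accounts for the motion of the point. This is checked by
hand for k = 0; one passes from k to k + 1 by the space derivative
(1 / phi_t') d/du, whose commutator with d/dt is - w_1 (c_t) times itself. By
the chain rule ([is_derive_peval]) the time derivative of v (c_t) is the value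
at c_t of phi_geo v + w_0 D v = phi_geo_hat v + w_1 v ([phi_geo_hatE]), and
w_1 (c_t) is the logarithmic time derivative of phi_t' (u). Hence the time
derivative of v (c_t) / phi_t' (u) is phi_geo_hat v (c_t) / phi_t' (u).

If phi_geo_hat v = 0, this quotient is constant ([is_derive_flow]). Every
diffeomorphism phi is reached at time 1 from the linear map u |-> s u, where
s = 1 or -1 is the sign of phi', without the slope ever vanishing; and linear
maps preserve Upsilon (v) because every monomial of v has weight 1
([peval_weight]). Orientation-reversing phi have to be dealt with, as all
self-maps of the line are homotopic to the identity.

Conversely, if v is covariant, differentiating at t = 0 a path that starts at
the identity shows that phi_geo_hat v vanishes at the jets at 0 of
([sigma], [Gamma], [eta]). These jets are arbitrary up to any given order,
even with eta' bounded, which makes id + t eta a diffeomorphism for small t: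
combinations of powers of the sine suffice ([jet_interpolation]). So
phi_geo_hat v is a polynomial function that vanishes everywhere, and it is
the zero polynomial ([peval_inj]). *)

(** * Evaluation of polynomials *)

Section Evaluation.
Variables (I : choiceType) (R : comNzRingType).
Implicit Types (c : I -> R) (m : {cmonom I}) (p q : {malg R[{cmonom I}]}).

Definition meval c m : R := \prod_(i <- finsupp m) c i ^+ m i.

Lemma mevalEw c m (E : {fset I}) : (finsupp m `<=` E)%fset ->
  meval c m = \prod_(i <- E) c i ^+ m i.
Proof.
move=> mE; rewrite /meval (big_fset_incl _ mE) // => i _.
by rewrite -cmE_eq0 => /eqP ->; rewrite expr0.
Qed.

Lemma meval1 c : meval c mone = 1.
Proof. by rewrite /meval mdom1 big_seq_fset0. Qed.

Lemma mevalM c m1 m2 : meval c (mmul m1 m2) = meval c m1 * meval c m2.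
Proof.
rewrite (@mevalEw c m1 (finsupp m1 `|` finsupp m2)%fset) ?fsubsetUl //.
rewrite (@mevalEw c m2 (finsupp m1 `|` finsupp m2)%fset) ?fsubsetUr //.
rewrite /meval mdomD -big_split; apply: eq_bigr => i _.
by rewrite cmM exprD.
Qed.

HB.instance Definition _ c := monalg.isMultiplicative.Build _ _ (meval c)
  (mevalM c, meval1 c).

Definition peval c : {malg R[{cmonom I}]} -> R := mmap idfun (meval c).

HB.instance Definition _ c := GRing.RMorphism.on (peval c).

Lemma pevalE c p : peval c p = \sum_(m <- msupp p) p@_m * meval c m.
Proof. exact: mmapE. Qed.

Lemma peval0 c : peval c 0 = 0.
Proof. exact: rmorph0. Qed.

Lemma pevalD c p q : peval c (p + q) = peval c p + peval c q.
Proof. exact: rmorphD. Qed.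

Lemma pevalN c p : peval c (- p) = - peval c p.
Proof. exact: rmorphN. Qed.

Lemma pevalM c p q : peval c (p * q) = peval c p * peval c q.
Proof. exact: rmorphM. Qed.

Lemma pevalZ c a p : peval c (a *: p) = a * peval c p.
Proof. exact: mmapZ. Qed.

Lemma peval_monom c a m : peval c << a *g m >> = a * meval c m.
Proof. exact: mmapU. Qed.

Lemma peval_var c i : peval c (mvar R i) = c i.
Proof. by rewrite peval_monom mul1r /meval mdomU big_seq_fset1 cmUU expr1. Qed.

Lemma eq_peval c c' p :
  (forall m i, m \in msupp p -> i \in finsupp m -> c i = c' i) ->
  peval c p = peval c' p.
Proof.
move=> cc'; rewrite !pevalE; apply: eq_big_seq => m mp; congr (_ * _).
by apply: eq_big_seq => i im; rewrite (cc' m).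
Qed.

Lemma derivDl d1 d2 p :
  deriv (fun i => d1 i + d2 i) p = deriv d1 p + deriv d2 p.
Proof.
rewrite /deriv -big_split; apply: eq_bigr => m _ /=.
rewrite -scalerDr; congr (_ *: _); rewrite /derivm -big_split.
by apply: eq_bigr => i _; rewrite mulrDr.
Qed.

Lemma derivMl q d p : deriv (fun i => q * d i) p = q * deriv d p.
Proof.
rewrite /deriv mulr_sumr; apply: eq_bigr => m _ /=.
rewrite -scalerAr; congr (_ *: _); rewrite /derivm mulr_sumr.
by apply: eq_bigr => i _; rewrite mulrCA.
Qed.

(** A derivation is determined by its values on the variables. *)
Lemma deriv_mvar d p : deriv (fun i => deriv d (mvar R i)) p = deriv d p.
Proof. by congr (deriv _ p); apply/funext => i; rewrite deriv_var. Qed.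

End Evaluation.

(** * A polynomial that vanishes everywhere is zero *)

Section Vanishing.
Variables (I : choiceType) (R : numDomainType).
Implicit Types (c : I -> R) (m : {cmonom I}).

Lemma meval_scale a c i m :
  meval (fun j => if j == i then a * c j else c j) m = a ^+ m i * meval c m.
Proof.
set E := (finsupp m `|` [fset i])%fset.
have mE : (finsupp m `<=` E)%fset by exact: fsubsetUl.
have iE : i \in E by rewrite !inE eqxx orbT.
rewrite !(mevalEw _ mE) !(big_fsetD1 i iE) /= eqxx exprMn mulrA.
congr (_ * _); rewrite big_seq_cond [RHS]big_seq_cond; apply: eq_bigr => j.
by rewrite !inE andbT => /andP[/negPf ->].
Qed.

(** Artin's argument for the independence of characters, by induction on the
number of monomials: two distinct monomials are separated by the doubling of a
variable i on which their exponents differ, since a |-> 2 ^+ a is injective. *)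
Lemma meval_indep (s : seq {cmonom I}) (a : {cmonom I} -> R) : uniq s ->
  (forall c, \sum_(m <- s) a m * meval c m = 0) -> {in s, forall m, a m = 0}.
Proof.
elim: s a => [//|m s IHs] a /= /andP[ms us] sum0.
have as0 : {in s, forall m', a m' = 0}.
  move=> m' m's.
  have [i mi] : exists i, m' i != m i.
    apply: contrapT => h; move: ms; rewrite (_ : m = m') ?m's //.
    apply/eqP/cmP => i; apply: contrapT => mi; apply: h; exists i.
    by apply/eqP => m'i; apply: mi.
  (* Doubling the i-th variable multiplies the monomial k by 2 ^+ k i; this
     relation minus 2 ^+ m i times the given one has no term in m left. *)
  have sum0i c : \sum_(k <- s) a k * (2 ^+ k i - 2 ^+ m i) * meval c k = 0.
    have := sum0 (fun j => if j == i then 2 * c j else c j).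
    have := sum0 c; rewrite !big_cons meval_scale.
    under [X in _ -> _ + X = 0 -> _]eq_bigr do rewrite meval_scale.
    move=> /(canRL (addrK _)); rewrite sub0r mulrCA => ->.
    rewrite mulrN addrC => /eqP; rewrite subr_eq0 => /eqP e.
    under eq_bigr do rewrite mulrBr mulrBl.
    rewrite big_split /= sumrN; apply/eqP; rewrite subr_eq0 mulr_sumr in e *.
    apply/eqP; under eq_bigr do rewrite -mulrA.
    by rewrite e; apply: eq_bigr => k _; rewrite mulrCA mulrA.
  have /eqP := IHs _ us sum0i m' m's.
  rewrite mulf_eq0 => /orP[/eqP //|]; rewrite subr_eq0 => /eqP e.
  by rewrite (@ieexprIn R 2 _ _ _ _ e) ?eqxx ?ltr0n ?pnatr_eq1 in mi.
move=> k; rewrite inE => /predU1P[->|/as0 //].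
have := sum0 (fun=> 1); rewrite big_cons big_seq big1 ?addr0 => [|{}k /as0 ->].
  rewrite (_ : meval _ m = 1) ?mulr1 // /meval big1 // => j _.
  by rewrite expr1n.
by rewrite mul0r.
Qed.

Lemma peval_inj (p : {malg R[{cmonom I}]}) :
  (forall c, peval c p = 0) -> p = 0.
Proof.
move=> p0; apply/malgP => m; rewrite mcoeff0.
have [mp|/mcoeff_outdom //] := boolP (m \in msupp p).
apply: (@meval_indep (msupp p) (fun m => p@_m) _ _ m mp); first exact: fset_uniq.
by move=> c; rewrite -pevalE.
Qed.
End Vanishing.

(** * The chain rule for polynomials *)

Section ChainRule.
Variables (I : choiceType) (R : realType).
Variables (c : R -> I -> R) (d : I -> {malg R[{cmonom I}]}) (t : R).
Implicit Types (m : {cmonom I}) (p : {malg R[{cmonom I}]}).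

Let velocity i := is_derive t 1 (fun s => c s i) (peval (c t) (d i)).

Lemma is_derive_meval m : (forall i, i \in finsupp m -> velocity i) ->
  is_derive t 1 (fun s => meval (c s) m) (peval (c t) (derivm d m)).
Proof.
move: {2}(mdeg m) (erefl (mdeg m)) => n; elim: n m => [|n IHn] m mn ci.
  have -> : m = mone by exact: mdeg_eq0I.
  rewrite /derivm mdom1 big_seq_fset0 peval0.
  rewrite (_ : (fun=> _) = cst 1); first exact: is_derive_cst.
  by apply/funext => s; rewrite meval1.
have [i im] : exists i, i \in finsupp m.
  apply/fset0Pn; apply: contra_eq_neq mn => m0.
  by rewrite mdegE m0 big_seq_fset0.
pose m' := divcm m (ucm i).
have mE : m = mmul (ucm i) m'.
  apply/eqP/cmP => j; rewrite cmM divcmE subnKC // ucmE.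
  by case: eqVneq => [<-|//]; rewrite lt0n cmE_neq0.
have {}mn : mdeg m' = n by move: mn; rewrite mE mdegM mdegU => -[].
have /(IHn _ mn) dm' j : j \in finsupp m' -> velocity j.
  by move=> jm'; apply: ci; rewrite mE mdomD inE jm' orbT.
have dUi : derivm d (ucm i) = d i.
  by have := deriv_var d i; rewrite derivU scale1r.
have Ui s : meval (c s) (ucm i) = c s i.
  by rewrite -(peval_var (c s) i) peval_monom mul1r.
have dci := ci _ im; move: mE dm'; clearbody m' => -> dm'.
rewrite (_ : (fun s => _) = (fun s => c s i) * (fun s => meval (c s) m')); last first.
  by apply/funext => s; rewrite mevalM Ui.
apply: (is_derive_eq (is_deriveM dci dm')); rewrite derivmM dUi.
have aux (f g a b : R) (u w q r : {malg R[{cmonom I}]}) :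
    peval (c t) u = f -> peval (c t) w = g -> peval (c t) q = b ->
    peval (c t) r = a ->
    f * a + g * b = peval (c t) (q * w + u * r).
  move=> <- <- <- <-; apply: etrans (esym (pevalD _ _ _)).
  apply: etrans (esym (congr2 +%R (pevalM _ _ _) (pevalM _ _ _))).
  exact: etrans (addrC _ _) (congr1 (+%R^~ _) (mulrC _ _)).
apply: aux => //.
- exact: etrans (peval_monom _ _ _) (etrans (mul1r _) (Ui t)).
- exact: etrans (peval_monom _ _ _) (mul1r _).
Qed.

(** A curve whose velocity is the value of a polynomial vector field d
differentiates a polynomial p into the value of the derivation with values d
on the variables. The equation is asked only for the variables of p: below, it
holds for the coordinates x_k and y_k but not for w_k. *)
Lemma is_derive_peval p :
  (forall m i, m \in msupp p -> i \in finsupp m -> velocity i) ->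
  is_derive t 1 (fun s => peval (c s) p) (peval (c t) (deriv d p)).
Proof.
move=> ci.
have -> : peval (c t) (deriv d p) =
    \sum_(m <- msupp p) p@_m * peval (c t) (derivm d m).
  rewrite /deriv raddf_sum; apply: eq_bigr => m _; exact: pevalZ.
rewrite (_ : (fun s => _) = \sum_(m <- msupp p) (p@_m *: fun s => meval (c s) m)).
  have : forall m, m \in enum_fset (msupp p) ->
      is_derive t 1 (fun s => meval (c s) m) (peval (c t) (derivm d m)).
    by move=> m mp; apply: is_derive_meval => i; exact: ci.
  elim: (enum_fset _) => [_|].
    by rewrite !big_nil; exact: is_derive_cst.
  move=> m s IHs dm; rewrite !big_cons.
  apply: is_deriveD; first by have := dm _ (mem_head _ _); exact: is_deriveZ.
  by apply: IHs => k ks; apply: dm; rewrite inE ks orbT.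
by apply/funext => s; rewrite pevalE fct_sumE.
Qed.

End ChainRule.

(** * The drift polynomials *)

Section Drift.
Variable R : comNzRingType.
Implicit Types (p q v : dpoly R) (i : var).

Lemma DD p q : D (p + q) = D p + D q.
Proof. exact: derivD. Qed.

Lemma DN p : D (- p) = - D p.
Proof. by rewrite -scaleN1r /D derivZ scaleN1r. Qed.

Lemma DM p q : D (p * q) = D p * q + p * D q.
Proof. exact: derivM. Qed.

Lemma Dx k : D (x_ R k) = x_ R k.+1.
Proof. exact: deriv_var. Qed.

Lemma Dy k : D (y_ R k) = y_ R k.+1.
Proof. exact: deriv_var. Qed.

Lemma Dw k : D (w_ R k) = w_ R k.+1.
Proof. exact: deriv_var. Qed.

(** The velocity of the jets along a path of diffeomorphisms, seen from a
moving point: [phi_geo] is the variation at a fixed point of the line, and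
w_0 D that due to the speed w_0 of the point. *)
Definition drift i : dpoly R := phi_geo (mvar R i) + w_ R 0 * D (mvar R i).

Lemma phi_geo_hatE v : phi_geo_hat v = deriv drift v - w_ R 1 * v.
Proof.
have aux (a b c e f g : dpoly R) : c = g -> b = a + f * e ->
    a - (v * c - f * e) = b - g * v.
  by move=> <- ->; rewrite opprB addrA [c * v]mulrC.
apply: aux (Dw 0) _; apply: etrans (derivDl _ _ _) _.
apply: etrans (congr1 (fun z => z + _) (deriv_mvar _ _)) _.
apply: etrans (congr1 (fun z => _ + z) (derivMl _ _ _)) _.
exact: (congr1 (fun z => _ + _ * z) (deriv_mvar _ _)).
Qed.

Lemma phi_geo_X k : phi_geo (x_ R k) = iter k (@D R) (bracket (x_ R 0) (w_ R 0)).
Proof. exact: deriv_var. Qed.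

Lemma phi_geo_Y k :
  phi_geo (y_ R k) = - iter k.+1 (@D R) (y_ R 0 * w_ R 0) - 2 * w_ R k.+2.
Proof. exact: deriv_var. Qed.

Lemma phi_geo_XS k : phi_geo (x_ R k.+1) = D (phi_geo (x_ R k)).
Proof. exact: etrans (phi_geo_X k.+1) (esym (congr1 _ (phi_geo_X k))). Qed.

Lemma phi_geo_YS k : phi_geo (y_ R k.+1) = D (phi_geo (y_ R k)).
Proof.
have D2 k' : D (2 * w_ R k') = 2 * w_ R k'.+1.
  have D1 (z : dpoly R) : 2 * z = z + z.
    exact: etrans (mulr_natl _ _) (mulr2n _).
  apply: etrans (congr1 _ (D1 _)) (etrans (DD _ _) _).
  exact: etrans (congr2 +%R (Dw _) (Dw _)) (esym (D1 _)).
have aux (a b c d : dpoly R) : a = b -> c = d -> - a - c = - b - d.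
  by move=> -> ->.
apply: etrans (phi_geo_Y k.+1) (esym _).
apply: etrans (congr1 _ (phi_geo_Y k)) _; apply: etrans (DD _ _) _.
apply: etrans (congr2 +%R (DN _) (DN _)) _.
exact: aux (erefl _) (D2 k.+2).
Qed.

Lemma drift_X0 : drift (X 0) = x_ R 0 * w_ R 1.
Proof.
have aux (p x0 dx w0 w1 dw : dpoly R) :
    p = x0 * dw - w0 * dx -> dw = w1 -> p + w0 * dx = x0 * w1.
  by move=> -> ->; rewrite subrK.
exact: aux (phi_geo_X 0) (Dw 0).
Qed.

Lemma drift_Y0 : drift (Y 0) = - (y_ R 0 * w_ R 1) - 2 * w_ R 2.
Proof.
have aux (p m y0 dy w0 w1 dw w2 : dpoly R) :
    p = - m - 2 * w2 -> m = dy * w0 + y0 * dw -> dw = w1 ->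
    p + w0 * dy = - (y0 * w1) - 2 * w2.
  move=> -> -> ->; rewrite opprD addrAC [w0 * _]mulrC; congr (_ - _).
  by rewrite addrAC addNr add0r.
exact: aux (phi_geo_Y 0) (DM _ _) (Dw 0).
Qed.

(** The commutator of the derivation [drift] with D is - w_1 D: [phi_geo]
commutes with D on the variables, and w_0 D contributes - (D w_0) D. *)
Let driftS i i' : phi_geo (mvar R i') = D (phi_geo (mvar R i)) ->
  D (mvar R i) = mvar R i' -> drift i' = D (drift i) - w_ R 1 * mvar R i'.
Proof.
have aux (p dp d dm dx x ddx w0 w1 dw : dpoly R) :
    p = dp -> d = dp + dm -> dm = dw * dx + w0 * ddx -> dw = w1 -> dx = x ->
    p + w0 * ddx = d - w1 * x.
  by move=> -> -> -> -> ->; rewrite [_ * x + _]addrC addrA addrK.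
move=> pS xS.
apply: etrans (congr1 (fun z => _ + _ * D z) (esym xS)) _.
exact: aux pS (DD _ _) (DM _ _) (Dw 0) xS.
Qed.

Lemma drift_XS k :
  drift (X k.+1) = D (drift (X k)) - w_ R 1 * x_ R k.+1.
Proof. exact: driftS (phi_geo_XS k) (Dx k). Qed.

Lemma drift_YS k :
  drift (Y k.+1) = D (drift (Y k)) - w_ R 1 * y_ R k.+1.
Proof. exact: driftS (phi_geo_YS k) (Dy k). Qed.

End Drift.

(** * Smooth functions *)

Section RealDerivatives.
Variable R : realType.
Implicit Types (f g : R -> R) (u a b : R).

Lemma is_derive_add f g u a b : is_derive u 1 f a -> is_derive u 1 g b ->
  is_derive u 1 (fun x => f x + g x) (a + b).
Proof. exact: is_deriveD. Qed.

Lemma is_derive_mul f g u a b : is_derive u 1 f a -> is_derive u 1 g b ->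
  is_derive u 1 (fun x => f x * g x) (a * g u + f u * b).
Proof.
move=> df dg; apply: (is_derive_eq (is_deriveM df dg)).
by rewrite addrC [X in X + _]mulrC.
Qed.

Lemma is_derive_inv f u a : f u != 0 -> is_derive u 1 f a ->
  is_derive u 1 (fun x => (f x)^-1) (- ((f u)^-1 * (f u)^-1 * a)).
Proof.
move=> fu df; apply: (is_derive_eq (is_deriveV fu df)).
by rewrite scaleNr expr2 invfM.
Qed.

Lemma is_derive_comp f g u a b : is_derive (g u) 1 f a -> is_derive u 1 g b ->
  is_derive u 1 (fun x => f (g x)) (a * b).
Proof. by move=> df dg; exact: is_derive1_comp. Qed.

Lemma derive1_val f u a : is_derive u 1 f a -> derive1 f u = a.
Proof. by move=> [_ <-]; rewrite derive1E. Qed.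

Lemma smooth_derivable f u : smooth f -> derivable f u 1.
Proof. exact: (fun h => h 0 u). Qed.

Lemma smooth_is_derive f u : smooth f -> is_derive u 1 f (derive1 f u).
Proof. by move=> sf; rewrite derive1E; apply/derivableP/smooth_derivable. Qed.

Lemma smooth_derive1 f : smooth f -> smooth (derive1 f).
Proof. by move=> sf n u; have := sf n.+1 u; rewrite derive1Sn. Qed.

Lemma derive1n_cst n a : derive1n n.+1 (cst a) = cst 0.
Proof.
elim: n => [|n IHn]; last rewrite derive1nS IHn; apply/funext => u;
  exact: derive1_cst.
Qed.

Lemma smooth_cst a : smooth (cst a).
Proof. by case=> [|n] u; rewrite ?derive1n_cst; exact: derivable_cst. Qed.

Lemma derive1nZ n a f : smooth f ->
  derive1n n (fun u => a * f u) = fun u => a * derive1n n f u.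
Proof.
move=> sf; elim: n => [//|n IHn]; rewrite derive1nS IHn; apply/funext => u.
apply: derive1_val; rewrite derive1nS derive1E.
have := is_derive_mul (is_derive_cst a u 1) (derivableP (sf n u)).
by rewrite mul0r add0r.
Qed.

(** Closure properties of smooth functions go by induction on the order of
differentiability: the derivative of a product, an inverse or a composite is
built from the same functions and their derivatives, to an order smaller by
one. *)
Definition smooth_upto n f := forall k u, (k < n)%N -> derivable (derive1n k f) u 1.

Lemma smoothP f : smooth f <-> forall n, smooth_upto n f.
Proof.
by split=> [sf n k u _|sf n u]; [exact: sf|exact: (sf n.+1)].
Qed.

Lemma smooth_upto0 f : smooth_upto 0 f. Proof. by []. Qed.

Lemma smooth_uptoS n f (f' : R -> R) : (forall u, is_derive u 1 f (f' u)) ->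
  smooth_upto n f' -> smooth_upto n.+1 f.
Proof.
move=> df sf' [|k] u; first by move=> _; case: (df u).
rewrite ltnS => /(sf' k u); rewrite derive1Sn (_ : derive1 f = f') //.
by apply/funext => z; exact: derive1_val.
Qed.

Lemma smooth_upto_derive n f : smooth_upto n.+1 f ->
  [/\ forall u, is_derive u 1 f (derive1 f u), smooth_upto n f &
      smooth_upto n (derive1 f)].
Proof.
move=> sf; split=> [u|k u kn|k u kn].
- by rewrite derive1E; apply/derivableP/(sf 0).
- by apply: sf; exact: leqW.
- by rewrite -derive1Sn; exact: (sf k.+1).
Qed.

Lemma smooth_upto_add n f g : smooth_upto n f -> smooth_upto n g ->
  smooth_upto n (fun u => f u + g u).
Proof.
elim: n f g => [|n IHn] f g; first by move=> _ _; exact: smooth_upto0.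
move=> /smooth_upto_derive[df _ sf'].
move=> /smooth_upto_derive[dg _ sg'].
apply: smooth_uptoS _ (IHn _ _ sf' sg') => u; exact: is_derive_add.
Qed.

Lemma smooth_upto_mul n f g : smooth_upto n f -> smooth_upto n g ->
  smooth_upto n (fun u => f u * g u).
Proof.
elim: n f g => [|n IHn] f g; first by move=> _ _; exact: smooth_upto0.
move=> /smooth_upto_derive[df sf sf'].
move=> /smooth_upto_derive[dg sg sg'].
apply: smooth_uptoS _ (smooth_upto_add (IHn _ _ sf' sg) (IHn _ _ sf sg')) => u.
exact: is_derive_mul.
Qed.

Lemma smooth_upto_cst n a : smooth_upto n (cst a).
Proof. exact: (smoothP _).1 (@smooth_cst a) n. Qed.

Lemma smooth_upto_inv n f : (forall u, f u != 0) -> smooth_upto n f ->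
  smooth_upto n (fun u => (f u)^-1).
Proof.
move=> f0; elim: n => [|n IHn]; first by move=> _; exact: smooth_upto0.
move=> /smooth_upto_derive[df sf sf'].
have sfV := IHn sf.
apply: (@smooth_uptoS _ _ (fun u => -1 * ((f u)^-1 * (f u)^-1 * derive1 f u))).
  by move=> u; rewrite mulN1r; exact: is_derive_inv.
apply: smooth_upto_mul (@smooth_upto_cst n (-1)) _.
exact: smooth_upto_mul (smooth_upto_mul sfV sfV) sf'.
Qed.

Lemma smooth_upto_comp n f g : smooth_upto n f -> smooth_upto n g ->
  smooth_upto n (fun u => f (g u)).
Proof.
elim: n f => [|n IHn] f; first by move=> _ _; exact: smooth_upto0.
move=> /smooth_upto_derive[df sf sf'].
move=> /smooth_upto_derive[dg sg sg'].
exact: smooth_uptoS _ (smooth_upto_mul (IHn _ sf' sg) sg').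
Qed.

Lemma smooth_add f g : smooth f -> smooth g -> smooth (fun u => f u + g u).
Proof. by move=> /smoothP sf /smoothP sg; apply/smoothP => n; exact: smooth_upto_add. Qed.

Lemma smooth_mul f g : smooth f -> smooth g -> smooth (fun u => f u * g u).
Proof. by move=> /smoothP sf /smoothP sg; apply/smoothP => n; exact: smooth_upto_mul. Qed.

Lemma smooth_id : smooth (@id R).
Proof.
apply/smoothP => -[|n]; first exact: smooth_upto0.
by apply: (@smooth_uptoS _ _ (cst 1)); exact: smooth_upto_cst.
Qed.

Lemma smooth_continuous f : smooth f -> continuous f.
Proof.
by move=> sf u; apply/differentiable_continuous/derivable1_diffP/smooth_derivable.
Qed.

(** The line is convex, so that the straight homotopy always works. *)
Lemma homotopic_smooth f g : smooth f -> smooth g -> homotopic f g.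
Proof.
move=> sf sg; exists (fun p => (1 - p.1) * f p.2 + p.1 * g p.2); split.
- apply: continuous_subspaceT => p.
  have cf : {for p, continuous (fun p : R * R => f p.2)}.
    by apply: continuous_comp; [exact: cvg_snd|exact: smooth_continuous].
  have cg : {for p, continuous (fun p : R * R => g p.2)}.
    by apply: continuous_comp; [exact: cvg_snd|exact: smooth_continuous].
  have c1 : {for p, continuous (fun p : R * R => p.1)} by exact: cvg_fst.
  have c1' : {for p, continuous (fun p : R * R => 1 - p.1)}.
    by apply: continuousB => //; exact: cst_continuous.
  exact: (continuousD (continuousM c1' cf) (continuousM c1 cg)).
- by move=> u /=; rewrite subr0 mul1r mul0r addr0.
- by move=> u /=; rewrite subrr mul0r mul1r add0r.
Qed.

End RealDerivatives.

(** * Jets along a path of diffeomorphisms *)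

Section JetCalculus.
Variables (R : realType) (s : R) (eta Gamma sigma : R -> R).
Hypotheses (eta_smooth : smooth eta).
Hypotheses (Gamma_smooth : smooth Gamma) (sigma_smooth : smooth sigma).

Implicit Types (t u : R) (p : dpoly R) (i : var).

(** The functions of (t, u) needed here: polynomials in t, functions of u and
the inverse slope of phi_t. They are kept as syntax because this class is
closed under both partial derivatives, which then commute by computation. *)
Inductive expr :=
| Coef of (R -> R)
| Time
| Slope_inv
| Plus of expr & expr
| Times of expr & expr.

Implicit Type e : expr.

Definition slope t u : R := s + t * derive1 eta u.

Fixpoint ev e t u : R :=
  match e with
  | Coef f => f u
  | Time => t
  | Slope_inv => (slope t u)^-1
  | Plus a b => ev a t u + ev b t u
  | Times a b => ev a t u * ev b t u
  end.

Fixpoint smooth_coef e : Prop :=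
  match e with
  | Coef f => smooth f
  | Plus a b | Times a b => smooth_coef a /\ smooth_coef b
  | _ => True
  end.

(** The derivative of 1 / slope, given that e is the one of the slope. *)
Definition dSlope_inv e :=
  Times (Coef (cst (-1))) (Times (Times Slope_inv Slope_inv) e).

Fixpoint du e :=
  match e with
  | Coef f => Coef (derive1 f)
  | Time => Coef (cst 0)
  | Slope_inv => dSlope_inv (Times Time (Coef (derive1n 2 eta)))
  | Plus a b => Plus (du a) (du b)
  | Times a b => Plus (Times (du a) b) (Times a (du b))
  end.

Fixpoint dt e :=
  match e with
  | Coef f => Coef (cst 0)
  | Time => Coef (cst 1)
  | Slope_inv => dSlope_inv (Coef (derive1 eta))
  | Plus a b => Plus (dt a) (dt b)
  | Times a b => Plus (Times (dt a) b) (Times a (dt b))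
  end.

Lemma smooth_coef_du e : smooth_coef e -> smooth_coef (du e).
Proof.
elim: e => [f|||a IHa b IHb|a IHa b IHb] /=.
- exact: smooth_derive1.
- by move=> _; exact: smooth_cst.
- move=> _; split; first exact: smooth_cst.
  do 2!(split; first by []).
  exact/smooth_derive1/smooth_derive1.
- by case=> /IHa ? /IHb.
- by case=> ? ?; do 2!split=> //; [exact: IHa|exact: IHb].
Qed.

Lemma smooth_coef_dt e : smooth_coef e -> smooth_coef (dt e).
Proof.
elim: e => [f|||a IHa b IHb|a IHa b IHb] /=.
- by move=> _; exact: smooth_cst.
- by move=> _; exact: smooth_cst.
- move=> _; split; first exact: smooth_cst.
  by split; [|exact: smooth_derive1].
- by case=> /IHa ? /IHb.
- by case=> ? ?; do 2!split=> //; [exact: IHa|exact: IHb].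
Qed.

(** Clairaut's theorem for this class; only its case of the inverse slope is
not formal. *)
Lemma ev_dtdu e t u : ev (dt (du e)) t u = ev (du (dt e)) t u.
Proof.
elim: e => [f|||a IHa b IHb|a IHa b IHb] /=; rewrite ?derive1_cst //.
- rewrite /cst /=; ring.
- by rewrite IHa IHb.
- rewrite IHa IHb; ring.
Qed.

Lemma ev_du e t u : smooth_coef e -> slope t u != 0 ->
  is_derive u 1 (ev e t) (ev (du e) t u).
Proof.
move=> + tu0; elim: e => [f|||a IHa b IHb|a IHa b IHb] /=.
- exact: smooth_is_derive.
- by move=> _; exact: is_derive_cst.
- move=> _; have d2 := smooth_is_derive u (smooth_derive1 eta_smooth).
  have ds : is_derive u 1 (slope t)
      (0 + (0 * derive1 eta u + t * derive1n 2 eta u)).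
    apply: is_derive_add (is_derive_cst _ _ _) _.
    exact: is_derive_mul (is_derive_cst _ _ _) d2.
  apply: (is_derive_eq (is_derive_inv tu0 ds)).
  by rewrite mul0r !add0r mulN1r.
- by move=> [/IHa da /IHb db]; exact: is_derive_add.
- by move=> [/IHa da /IHb db]; exact: is_derive_mul.
Qed.

Lemma ev_dt e t u : slope t u != 0 ->
  is_derive t 1 (ev e ^~ u) (ev (dt e) t u).
Proof.
move=> tu0; elim: e => [f|||a IHa b IHb|a IHa b IHb] /=.
- exact: is_derive_cst.
- exact: is_derive_id.
- have ds : is_derive t 1 (slope ^~ u) (0 + (1 * derive1 eta u + t * 0)).
    apply: is_derive_add (is_derive_cst _ _ _) _.
    exact: is_derive_mul (is_derive_id _ _) (is_derive_cst _ _ _).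
  apply: (is_derive_eq (@is_derive_inv _ (slope ^~ u) _ _ tu0 ds)).
  by rewrite mulr0 addr0 add0r mul1r mulN1r.
- exact: is_derive_add.
- exact: is_derive_mul.
Qed.

(** The derivative with respect to z = phi_t (u) instead of u. *)
Definition dz e := Times Slope_inv (du e).

(** phi_t.sigma and phi_t.Gamma at the point phi_t (u). *)
Definition sigma_expr :=
  Times (Plus (Coef (cst s)) (Times Time (Coef (derive1 eta)))) (Coef sigma).

Definition Gamma_expr :=
  Plus (Times Slope_inv (Coef Gamma))
    (dSlope_inv (Times Time (Coef (derive1n 2 eta)))).

Definition jet_expr i : expr :=
  match i with
  | X k => iter k dz sigma_expr
  | Y k => iter k dz (Times (Coef (cst 2)) Gamma_expr)
  | W k => iter k dz (Coef eta)
  end.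

(** The jets at phi_t (u) of phi_t.sigma, 2 phi_t.Gamma and of the velocity
field of the path. *)
Definition curve t u i : R := ev (jet_expr i) t u.

Lemma smooth_coef_iter_dz k e : smooth_coef e -> smooth_coef (iter k dz e).
Proof. by move=> we; elim: k => //= k IHk; split=> //; exact: smooth_coef_du. Qed.

Lemma smooth_coef_sigma_expr : smooth_coef sigma_expr.
Proof.
split; last exact: sigma_smooth.
split; first exact: smooth_cst.
by split; [exact: I|exact: smooth_derive1].
Qed.

Lemma smooth_coef_Gamma_expr : smooth_coef Gamma_expr.
Proof.
split; first exact: conj I Gamma_smooth.
split; first exact: smooth_cst.
do 2!(split; first by []).
exact/smooth_derive1/smooth_derive1.
Qed.

Lemma smooth_coef_jet_expr i : smooth_coef (jet_expr i).
Proof.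
have cstS := @smooth_cst R.
case: i => k.
- exact: smooth_coef_iter_dz smooth_coef_sigma_expr.
- by apply: smooth_coef_iter_dz; split; [exact: cstS|exact: smooth_coef_Gamma_expr].
- by apply: smooth_coef_iter_dz; exact: eta_smooth.
Qed.

(** D represents the derivative d/dz, and d/du is slope times d/dz. *)
Lemma is_derive_curve_u t u p : slope t u != 0 ->
  is_derive u 1 (fun u => peval (curve t u) p)
    (slope t u * peval (curve t u) (D p)).
Proof.
move=> tu0.
have key i : peval (curve t u) ((slope t u)%:MP * D (mvar R i))
    = ev (du (jet_expr i)) t u.
  have aux (q : dpoly R) j : q = mvar R j ->
      curve t u j = (slope t u)^-1 * ev (du (jet_expr i)) t u ->
      peval (curve t u) ((slope t u)%:MP * q) = ev (du (jet_expr i)) t u.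
    move=> -> cj; apply: etrans (pevalM _ _ _) _.
    apply: etrans (congr2 *%R (mmapC _) (etrans (peval_var _ _) cj)) _.
    by rewrite /= mulVKf.
  by case: i aux => k aux; [apply: aux (Dx R k) _|apply: aux (Dy R k) _|
    apply: aux (Dw R k) _].
have dc i : is_derive u 1 (fun u => curve t u i)
    (peval (curve t u) ((slope t u)%:MP * D (mvar R i))).
  by rewrite key; exact: ev_du (smooth_coef_jet_expr i) tu0.
apply: is_derive_eq (is_derive_peval (fun _ i _ _ => dc i)) _.
apply: etrans (congr1 _ (etrans (derivMl _ _ _) (congr1 _ (deriv_mvar _ _)))) _.
exact: etrans (pevalM _ _ _) (congr1 ( *%R^~ _) (mmapC _)).
Qed.

(** The differential equation of the jets: for k = 0 it is the derivative in t
of the transformation rules of a vector field and of a Christoffel symbol, and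
the passage from k to k + 1 compares the commutator of d/dt and d/dz with that
of [drift] and D. The slope has to be nonzero at all u, because the equation
for k is differentiated in u. *)
Lemma curve_drift t : (forall u, slope t u != 0) -> forall u i, ~~ is_W i ->
  ev (dt (jet_expr i)) t u = peval (curve t u) (drift R i).
Proof.
move=> t0.
have step i j : jet_expr j = dz (jet_expr i) ->
    drift R j = D (drift R i) - w_ R 1 * mvar R j ->
    (forall u, ev (dt (jet_expr i)) t u = peval (curve t u) (drift R i)) ->
    forall u, ev (dt (jet_expr j)) t u = peval (curve t u) (drift R j).
  move=> ej dj IH u; rewrite dj ej.
  have dIH : ev (du (dt (jet_expr i))) t u =
      slope t u * peval (curve t u) (D (drift R i)).
    rewrite -(derive1_val (is_derive_curve_u _ (t0 u))).
    have sm := smooth_coef_dt (smooth_coef_jet_expr i).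
    rewrite -(derive1_val (ev_du sm (t0 u))).
    by congr (derive1 _ u); apply/funext => u'; exact: IH.
  apply: etrans _ (esym (pevalD _ _ _)).
  apply: etrans _ (congr1 (fun z => _ + z)
    (esym (etrans (pevalN _ _) (congr1 -%R (pevalM _ _ _))))).
  apply: etrans _ (congr2 (fun z z' => _ - z * z')
    (esym (peval_var _ _)) (esym (peval_var _ _))).
  rewrite /curve ej /= ev_dtdu dIH mulKf //.
  rewrite mulN1r mulNr addrC; congr (_ - _).
  by rewrite -!mulrA; congr (_ * _); rewrite mulrCA.
have base_X u : ev (dt (jet_expr (X 0))) t u = peval (curve t u) (drift R (X 0)).
  apply: etrans _ (esym (congr1 _ (drift_X0 R))).
  apply: etrans _ (esym (pevalM _ _ _)).
  apply: etrans _ (esym (congr2 *%R (peval_var _ _) (peval_var _ _))).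
  rewrite /curve /= /cst; have := t0 u; rewrite /slope.
  by move: (derive1 eta u) (sigma u) => a b p0; field.
have base_Y u : ev (dt (jet_expr (Y 0))) t u = peval (curve t u) (drift R (Y 0)).
  have peval2 : peval (curve t u) 2 = 2 by exact: rmorph_nat.
  apply: etrans _ (esym (congr1 _ (drift_Y0 R))).
  apply: etrans _ (esym (pevalD _ _ _)).
  apply: etrans _ (esym (congr2 +%R (pevalN _ _) (pevalN _ _))).
  apply: etrans _ (esym (congr2 (fun z z' => - z - z')
    (pevalM _ _ _) (pevalM _ _ _))).
  apply: etrans _ (esym (congr2 (fun z z' => - z - z')
    (congr2 *%R (peval_var _ _) (peval_var _ _))
    (congr2 *%R peval2 (peval_var _ _)))).
  rewrite /curve /= /cst.
  by move: (slope t u)^-1 (derive1 (derive1 eta) u) (derive1 eta u) => r a b; ring.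
move=> u [k|k|//] _; move: u.
  elim: k => [|k IHk] u; first exact: base_X.
  exact: (step (X k) (X k.+1) (erefl _) (drift_XS R k) IHk u).
elim: k => [|k IHk] u; first exact: base_Y.
exact: (step (Y k) (Y k.+1) (erefl _) (drift_YS R k) IHk u).
Qed.

Lemma ev0_iter_dz u k e : smooth_coef e -> s != 0 ->
  ev (iter k dz e) 0 u = s ^- k * derive1n k (ev e 0) u.
Proof.
move=> we s0; elim: k u => [|k IHk] u; first by rewrite expr0 invr1 mul1r.
have s0u : slope 0 u != 0 by rewrite /slope mul0r addr0.
rewrite iterS /= {1}/slope mul0r addr0.
have -> : derive1n k (ev e 0) = fun u => s ^+ k * ev (iter k dz e) 0 u.
  by apply/funext => u'; rewrite IHk mulVKf ?expf_neq0.
have dk := is_derive_mul (is_derive_cst (s ^+ k) u 1)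
  (ev_du (smooth_coef_iter_dz k we) s0u).
by rewrite (derive1_val dk) mul0r add0r exprS invfM -mulrA mulKf ?expf_neq0.
Qed.

(** At t = 0 the map is linear, and the weight is defined so that u |-> s u
multiplies the jet coordinate x_k, or y_k, by s to the power of its weight. *)
Lemma curve0_weight u i : s != 0 -> ~~ is_W i ->
  curve 0 u i = s ^ weight i * jet Gamma sigma u i.
Proof.
move=> s0; case: i => // k _; rewrite /curve /jet_expr.
  rewrite (ev0_iter_dz _ _ smooth_coef_sigma_expr s0).
  rewrite (_ : ev sigma_expr 0 = fun u => s * sigma u).
    rewrite derive1nZ //= expfzDr // mulrA; congr (_ * _).
    by rewrite mulrC -exprnN.
  by apply/funext => u'; rewrite /= /cst mul0r addr0.
rewrite (ev0_iter_dz _ _ _ s0); last first.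
  by split; [exact: smooth_cst|exact: smooth_coef_Gamma_expr].
rewrite (_ : ev _ 0 = fun u => (2 / s) * Gamma u).
  rewrite derive1nZ //= opprD expfzDr // -!exprnN expr1 !mulrA; congr (_ * _).
  by rewrite [LHS]mulrC mulrA.
apply/funext => u'; rewrite /= /cst /slope mul0r addr0.
by rewrite mul0r !mulr0 addr0 mulrA.
Qed.

Lemma curve0_W u k : s = 1 -> curve 0 u (W k) = derive1n k eta u.
Proof.
move=> s1; rewrite /curve /jet_expr (@ev0_iter_dz u k (Coef eta)) ?s1 ?oner_eq0 //.
by rewrite expr1n invr1 mul1r.
Qed.

(* Here g stands for the inverse of phi_t: expressions become functions on the
   target line, and iterating dz computes their derivatives. *)
Section Along.
Variables (g : R -> R) (t : R).
Hypothesis slope_neq0 : forall u, slope t u != 0.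
Hypothesis dg : forall z : R, is_derive z 1 g (slope t (g z))^-1.

Lemma derive1n_along e k : smooth_coef e ->
  derive1n k (fun z => ev e t (g z)) = fun z => ev (iter k dz e) t (g z).
Proof.
move=> we; elim: k => [//|k IHk]; rewrite derive1nS IHk; apply/funext => z.
have de := ev_du (smooth_coef_iter_dz k we) (slope_neq0 (g z)).
rewrite (derive1_val (is_derive_comp de (dg z))).
by rewrite /= mulrC.
Qed.

Lemma smooth_along e : smooth_coef e -> smooth (fun z => ev e t (g z)).
Proof.
move=> we n z; rewrite derive1n_along //.
have de := ev_du (smooth_coef_iter_dz n we) (slope_neq0 (g z)).
by have [] := is_derive_comp de (dg z).
Qed.

End Along.

(** The link with the actions: [curve] has been defined by formulas, and this
identifies it with the jets of the transported pair whenever phi_t is a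
diffeomorphism. *)
Lemma jet_act (phi : diffeo R) t u i :
  (forall u, phi u = s * u + t * eta u) -> ~~ is_W i ->
  jet (act_christ phi Gamma) (act_vec phi sigma) (phi u) i = curve t u i.
Proof.
move=> phiE.
have dphi u' : derive1 phi u' = slope t u'.
  have := is_derive_add (is_derive_mul (is_derive_cst s u' 1) (is_derive_id u' 1))
    (is_derive_mul (is_derive_cst t u' 1) (smooth_is_derive u' eta_smooth)).
  rewrite /cst mul0r add0r mulr1 mul0r add0r => /derive1_val; rewrite /slope => <-.
  by congr (derive1 _ _); apply/funext => z; exact: phiE.
have d2phi u' : derive1n 2 phi u' = t * derive1n 2 eta u'.
  rewrite derive1nS /= (_ : derive1 phi = slope t); last exact/funext.
  have d2 := smooth_is_derive u' (smooth_derive1 eta_smooth).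
  have := is_derive_add (is_derive_cst s u' 1)
    (is_derive_mul (is_derive_cst t u' 1) d2).
  by rewrite /cst add0r mul0r add0r => /derive1_val <-.
have t0 u' : slope t u' != 0 by rewrite -dphi derive_diffeo_neq0.
have dg (z : R) : is_derive z 1 (dinv phi) (slope t (dinv phi z))^-1.
  have dp := smooth_is_derive (dinv phi z) (@dfun_smooth _ phi).
  have dd := smooth_is_derive z (@dinv_smooth _ phi).
  have := is_derive_comp dp dd.
  rewrite (_ : (fun _ => _) = id); last exact/funext/dinvK.
  move=> /derive1_val; rewrite derive1_id dphi => e.
  by apply: is_derive_eq dd _; rewrite -[LHS](mulKf (t0 (dinv phi z))) -e mulr1.
case: i => // k _; rewrite /jet /curve /jet_expr.
  rewrite (_ : act_vec phi sigma = fun z => ev sigma_expr t (dinv phi z)).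
    by rewrite (derive1n_along t0 dg _ smooth_coef_sigma_expr) dfunK.
  by apply/funext => z; rewrite /act_vec dphi.
rewrite (_ : act_christ phi Gamma = fun z => ev Gamma_expr t (dinv phi z)).
  have := derive1nZ k 2 (smooth_along t0 dg smooth_coef_Gamma_expr).
  move=> /(congr1 (fun f => f (phi u))) <-.
  rewrite (derive1n_along (e := Times (Coef (cst 2)) Gamma_expr) t0 dg).
    by rewrite dfunK.
  by split; [exact: smooth_cst|exact: smooth_coef_Gamma_expr].
apply/funext => z; rewrite /act_christ dphi d2phi /= /cst.
have := t0 (dinv phi z).
by move: (slope t _) (Gamma _) (derive1 (derive1 eta) _) => p a b p0; field.
Qed.

End JetCalculus.

(** * From the algebraic condition to covariance *)

Section Covariance.
Variable R : realType.
Implicit Types (v : dpoly R) (u t z : R).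

Lemma calM_monom v m : calM v -> m \in msupp v -> monomM m.
Proof.
move=> [r [c [/allP rM ->]]]; rewrite -mcoeff_neq0; apply: contraNT => mM.
rewrite raddf_sum big_seq big1 // => k kr.
apply: etrans (mcoeffZ _ _ _) _; rewrite mcoeffU; case: eqP => [km|_].
  by rewrite -km rM in mM.
by rewrite mulr0.
Qed.

Lemma calM_noW v m i : calM v -> m \in msupp v -> i \in finsupp m -> ~~ is_W i.
Proof. by move=> /calM_monom vM /vM /and3P[/allP + _ _] => /[apply]. Qed.

(** Polynomials in the space M are homogeneous of weight 1. *)
Lemma peval_weight v (s : R) c : s != 0 -> calM v ->
  peval (fun i => s ^ weight i * c i) v = s * peval c v.
Proof.
move=> s0 vM; rewrite !pevalE mulr_sumr; apply: eq_big_seq => m mv.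
rewrite mulrCA; congr (_ * _).
have /and3P[_ /eqP wm _] := calM_monom vM mv.
have sE : s = \prod_(i <- finsupp m) s ^ ((m i)%:Z * weight i).
  rewrite -[LHS]expr1z -wm /mweight.
  exact: (big_morph (fun n => s ^ n) (fun a b => expfzDr a b s0) (expr0z s)).
rewrite [in RHS]sE /meval -big_split; apply: eq_bigr => i _ /=.
by rewrite exprMn [_%:Z * _]mulrC -exprz_exp -exprnP.
Qed.

Lemma UpsilonE Gamma sigma v u :
  Upsilon Gamma sigma v u = peval (jet Gamma sigma u) v.
Proof. by rewrite pevalE. Qed.

Section Flow.
Variables (s : R) (eta Gamma sigma : R -> R) (v : dpoly R).
Hypotheses (eta_smooth : smooth eta).
Hypotheses (Gamma_smooth : smooth Gamma) (sigma_smooth : smooth sigma).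
Hypothesis vM : calM v.

Let c := curve s eta Gamma sigma.

Lemma peval_curve0 u : s != 0 ->
  peval (c 0 u) v = s * Upsilon Gamma sigma v u.
Proof.
move=> s0; rewrite UpsilonE -peval_weight //; apply: eq_peval => m i mv im.
by apply: curve0_weight => //; exact: calM_noW mv im.
Qed.

Lemma peval_curve_diffeo (phi : diffeo R) t u :
  (forall u, phi u = s * u + t * eta u) ->
  peval (c t u) v =
  Upsilon (act_christ phi Gamma) (act_vec phi sigma) v (phi u).
Proof.
move=> phiE; rewrite UpsilonE; apply: eq_peval => m i mv im.
by apply/esym/jet_act => //; exact: calM_noW mv im.
Qed.

Lemma is_derive_curve_t t u : (forall u, slope s eta t u != 0) ->
  is_derive t 1 (fun t => peval (c t u) v) (peval (c t u) (deriv (drift R) v)).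
Proof.
move=> t0; apply: (@is_derive_peval _ R (c ^~ u)) => m i mv im.
rewrite -curve_drift //; last exact: calM_noW mv im.
exact: ev_dt.
Qed.

Lemma curve_W1 t u : c t u (W 1) = (slope s eta t u)^-1 * derive1 eta u.
Proof. by []. Qed.

Lemma peval_w1 t u p : peval (c t u) (w_ R 1 * p) =
  (slope s eta t u)^-1 * derive1 eta u * peval (c t u) p.
Proof. exact: etrans (pevalM _ _ _) (congr1 ( *%R^~ _) (peval_var _ _)). Qed.

(** v (c_t) and the slope have the same logarithmic derivative w_1 (c_t) when
[phi_geo_hat] v = 0. *)
Lemma is_derive_flow t u : (forall u, slope s eta t u != 0) ->
  phi_geo_hat v = 0 ->
  is_derive t 1 (fun t => peval (c t u) v / slope s eta t u) 0.
Proof.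
move=> t0; rewrite phi_geo_hatE => /subr0_eq dv.
have dc := is_derive_curve_t u t0; rewrite dv peval_w1 in dc.
have dr := ev_dt (Slope_inv R) (t0 u).
apply: is_derive_eq (is_derive_mul dc dr) _ => /=.
rewrite /cst; move: (slope s eta t u)^-1 (peval _ _) (derive1 eta u) => r a b.
ring.
Qed.

End Flow.

(** By the intermediate value theorem, phi' has a constant sign s. *)
Lemma diffeo_slope_sign (phi : diffeo R) :
  exists2 s : R, s ^+ 2 = 1 & forall u, 0 < s * derive1 phi u.
Proof.
have dphi u : derivable (derive1 phi) u 1 by exact: (@dfun_smooth _ phi 1).
have cphi (a b : R) : {within `[a, b], continuous (derive1 phi)}.
  by apply: derivable_within_continuous => u _.
have same a b : a <= b -> 0 < derive1 phi a * derive1 phi b.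
  move=> ab; rewrite ltNge; apply/negP => ab0.
  have [|c _ c0] := @IVT R (derive1 phi) a b 0 ab (cphi a b).
    move: ab0; rewrite ge_min le_max.
    by case: (leP (derive1 phi a) 0); case: (leP (derive1 phi b) 0) => //=; nra.
  by have := derive_diffeo_neq0 phi c; rewrite c0 eqxx.
have same' a b : 0 < derive1 phi a * derive1 phi b.
  by case: (leP a b) => [/same //|/ltW/same]; rewrite mulrC.
exists (Num.sg (derive1 phi 0)); first by rewrite sqr_sg derive_diffeo_neq0.
move=> u; have := same' 0 u; rewrite {1}[derive1 phi 0]numEsg -mulrA mulrCA.
by rewrite pmulr_rgt0 // normr_gt0 derive_diffeo_neq0.
Qed.

Lemma phi_geo_hat0_covariant v (phi : diffeo R) Gamma sigma :
  smooth Gamma -> smooth sigma -> calM v -> phi_geo_hat v = 0 ->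
  act_vec phi (Upsilon Gamma sigma v)
  = Upsilon (act_christ phi Gamma) (act_vec phi sigma) v.
Proof.
move=> sG ss vM v0; have [s s2 sphi] := diffeo_slope_sign phi.
have s0 : s != 0 by apply: contra_eq_neq s2 => ->; rewrite expr0n eq_sym oner_neq0.
pose eta u := phi u - s * u.
have etaE : eta = fun u => phi u + - s * u.
  by apply/funext => u; rewrite mulNr.
have deta (u : R) : is_derive u 1 eta (derive1 phi u - s).
  have dphi := smooth_is_derive u (@dfun_smooth _ phi).
  have := is_derive_add dphi
    (is_derive_mul (is_derive_cst (- s) u 1) (is_derive_id u 1)).
  by rewrite etaE mul0r add0r mulr1.
have seta : smooth eta.
  rewrite etaE; apply: smooth_add; first exact: dfun_smooth.
  exact: smooth_mul (@smooth_cst _ (- s)) (@smooth_id R).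
have slopeE t u : slope s eta t u = (1 - t) * s + t * derive1 phi u.
  by rewrite /slope (derive1_val (deta u)); ring.
have slope0 t : 0 <= t <= 1 -> forall u, slope s eta t u != 0.
  move=> /andP[t0 t1] u.
  suff: 0 < s * slope s eta t u by apply: contraL => /eqP ->; rewrite mulr0 ltxx.
  (* On [0, 1] the slope interpolates between s and phi', both of sign s. *)
  rewrite slopeE mulrDr mulrCA -expr2 s2 mulr1 mulrCA.
  have := sphi u; move: (s * _) => a a0.
  have [->|t0'] := eqVneq t 0; first by rewrite subr0 mul0r addr0.
  by rewrite ltr_wpDl ?subr_ge0 // mulr_gt0 // lt_def t0'.
apply/funext => z; rewrite -(dinvK phi z); move: (dinv phi z) => {z} u.
rewrite act_vecE -(@peval_curve_diffeo s eta Gamma sigma v seta sG ss vM phi 1 u); last first.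
  by move=> u'; rewrite mul1r /eta addrC subrK.
(* F 0 is the value before transport, by homogeneity; F 1 the one after it,
   divided by phi' u. *)
pose F t := peval (curve s eta Gamma sigma t u) v / slope s eta t u.
have dF t : 0 <= t <= 1 -> is_derive t 1 F 0.
  by move=> t01; exact: is_derive_flow (slope0 t t01) v0.
have dF' t : t \in `]0, 1[ -> is_derive t 1 F 0.
  by rewrite in_itv /= => /andP[/ltW t0 /ltW t1]; apply: dF; rewrite t0.
have [|t _] := MVT_segment ler01 dF'.
  by apply: derivable_within_continuous => t; rewrite in_itv /= => /dF [].
rewrite mul0r => /subr0_eq; rewrite /F peval_curve0 //.
rewrite !slopeE subr0 subrr !mul0r mul1r addr0 mul1r add0r.
rewrite mulrAC mulfV // mul1r => FE.
by rewrite -FE mulrC divfK // derive_diffeo_neq0.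
Qed.

End Covariance.

(** * Diffeomorphisms close to the identity *)

Section SmoothInverse.
Variable R : realType.
Implicit Types (f g : R -> R) (u z : R).

(** The derivative of g is 1 / (f' o g), so that g gains one order of
differentiability from itself. *)
Lemma smooth_inverse f g : smooth f -> (forall u, derive1 f u != 0) ->
  cancel f g -> cancel g f -> smooth g.
Proof.
move=> sf f'0 fK gK.
have dg z : is_derive z 1 g (derive1 f (g z))^-1.
  have df := smooth_is_derive (g z) sf.
  rewrite -{1}(gK z); apply: (@is_derive_inverse _ f) => //.
    by apply: filterE => x; exact: fK.
  by apply: filterE => x; exact: smooth_continuous.
apply/smoothP => n; elim: n => [|n IHn]; first exact: smooth_upto0.
apply: (smooth_uptoS (f' := fun z => (derive1 f (g z))^-1) dg).
apply: smooth_upto_inv; first by move=> z; exact: f'0.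
exact: smooth_upto_comp ((smoothP _).1 (smooth_derive1 sf) n) IHn.
Qed.

(** A uniform positive lower bound a on f' gives surjectivity: f grows at
least like a u in both directions. *)
Lemma derive_ge_diffeo f (a : R) : smooth f -> 0 < a ->
  (forall u, a <= derive1 f u) -> exists phi : diffeo R, phi =1 f.
Proof.
move=> sf a0 fa.
have incr u z : u <= z -> a * (z - u) <= f z - f u.
  move=> uz; have [] := @MVT_segment R f (derive1 f) u z uz.
  - by move=> x _; exact: smooth_is_derive.
  - by apply: continuous_subspaceT; exact: smooth_continuous.
  - by move=> x _ ->; rewrite ler_wpM2r ?subr_ge0.
have finj : injective f.
  move=> u z fuz; wlog uz : u z fuz / u <= z.
    by move=> h; case: (leP u z) => [/h|/ltW/h] -> //.
  apply/eqP; rewrite eq_le uz -subr_le0 -(pmulr_rle0 _ a0).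
  by rewrite (le_trans (incr _ _ uz)) // fuz subrr.
have fsurj z : exists u, f u = z.
  (* On [0, b] and on [- b, 0], f varies by at least the distance from f 0 to z. *)
  pose b := `|z - f 0| / a.
  have b0 : 0 <= b by rewrite divr_ge0 // ltW.
  have ab : a * b = `|z - f 0| by rewrite mulrCA divff ?mulr1 // gt_eqF.
  have := incr _ _ b0; rewrite subr0 ab => fb.
  have : - b <= 0 by rewrite oppr_le0.
  move=> /incr; rewrite sub0r opprK ab => fNb.
  have bb : - b <= b by rewrite (le_trans _ b0) // oppr_le0.
  have [||u _ <-] := @IVT R f (- b) b z bb; last by exists u.
  - by apply: continuous_subspaceT; exact: smooth_continuous.
  - have := ler_norm (z - f 0); have := ler_norm (- (z - f 0)); rewrite normrN.
    rewrite ge_min le_max => h1 h2; apply/andP; split; apply/orP;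
      [left|right]; lra.
have [g gK] := choice fsurj.
have fK : cancel f g by move=> u; apply: finj.
have sg : smooth g.
  apply: smooth_inverse fK gK => // u.
  by rewrite gt_eqF // (lt_le_trans a0).
by exists (Diffeo sf sg fK gK).
Qed.

End SmoothInverse.

(** * Smooth functions with prescribed jets *)

Section JetInterpolation.
Variable R : realType.
Implicit Types (f g : R -> R) (u : R).

Lemma smooth_upto_sin_cos n : smooth_upto n (@sin R) /\ smooth_upto n (@cos R).
Proof.
elim: n => [|n [sS sC]]; first by split; exact: smooth_upto0.
split; first by apply: (smooth_uptoS (f' := @cos R)).
apply: (smooth_uptoS (f' := fun u => -1 * sin u)).
  by move=> u; rewrite mulN1r; exact: is_derive_cos.
exact: smooth_upto_mul (@smooth_upto_cst R n (-1)) sS.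
Qed.

Lemma smooth_sin : smooth (@sin R).
Proof. by apply/smoothP => n; have [] := smooth_upto_sin_cos n. Qed.

Lemma smooth_cos : smooth (@cos R).
Proof. by apply/smoothP => n; have [] := smooth_upto_sin_cos n. Qed.

Lemma is_derive_sinX n u :
  is_derive u 1 (fun x => sin x ^+ n.+1) (n.+1%:R * cos u * sin u ^+ n).
Proof.
elim: n => [|n IHn].
  by rewrite expr0 mulr1 mul1r; exact: is_derive_sin.
rewrite (_ : (fun _ => _) = fun x => sin x * sin x ^+ n.+1); last first.
  by apply/funext => x; rewrite exprS.
apply: is_derive_eq (is_derive_mul (is_derive_sin u) IHn) _.
by rewrite exprS [in RHS]mulrSr; ring.
Qed.

Lemma smooth_sinX n : smooth (fun u : R => sin u ^+ n).
Proof.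
elim: n => [|n IHn]; first exact: (@smooth_cst R 1).
rewrite (_ : (fun _ => _) = fun x : R => sin x * sin x ^+ n).
  exact: smooth_mul smooth_sin IHn.
by apply/funext => x; rewrite exprS.
Qed.

(** The function u |-> sin u ^+ n vanishes to order exactly n at 0. The factor
g makes the induction go through, as differentiating preserves this form and
lowers n by one. *)
Lemma derive1n_mul_sinX g n k : smooth g -> (k <= n)%N ->
  derive1n k (fun u => g u * sin u ^+ n) 0 =
  if k == n then n`!%:R * g 0 else 0.
Proof.
elim: k n g => [|k IHk] [|n] g sg //=.
- by rewrite expr0 mulr1 mul1r.
- by rewrite sin0 expr0n mulr0.
rewrite ltnS eqSS => kn; rewrite -derive1nS derive1Sn.
rewrite (_ : derive1 _ = fun u =>
    (derive1 g u * sin u + n.+1%:R * (g u * cos u)) * sin u ^+ n).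
  rewrite (IHk n _ _ kn).
    by rewrite sin0 cos0 mulr0 add0r mulr1 mulrA -natrM mulnC -factS.
  apply: smooth_add; first exact: smooth_mul (smooth_derive1 sg) smooth_sin.
  by apply: smooth_mul (@smooth_cst R _) _; exact: smooth_mul smooth_cos.
apply/funext => u.
rewrite (derive1_val (is_derive_mul (smooth_is_derive u sg) (is_derive_sinX n u))).
by rewrite exprS; ring.
Qed.

Lemma derive1nD n f g : smooth f -> smooth g ->
  derive1n n (fun u => f u + g u) = fun u => derive1n n f u + derive1n n g u.
Proof.
move=> sf sg; elim: n => [//|n IHn]; rewrite derive1nS IHn; apply/funext => u.
apply: derive1_val; rewrite !derive1nS !derive1E.
exact: is_derive_add (derivableP (sf n u)) (derivableP (sg n u)).
Qed.

(** Adding a multiple of sin ^+ n.+1 adjusts the derivative of order n.+1 at 0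
without changing the previous ones, and the derivative stays bounded. *)
Lemma jet_interpolation n (c : nat -> R) : exists h : R -> R,
  [/\ smooth h, exists M, forall u, `|derive1 h u| <= M &
      forall k, (k <= n)%N -> derive1n k h 0 = c k].
Proof.
elim: n => [|n [h [sh [M hM] hc]]].
  exists (cst (c 0)); split; first exact: smooth_cst.
    by exists 0 => u; rewrite derive1_cst normr0.
  by case.
pose a := (c n.+1 - derive1n n.+1 h 0) / (n.+1)`!%:R.
have sa : smooth (fun u => a * sin u ^+ n.+1).
  exact: smooth_mul (@smooth_cst R a) (@smooth_sinX n.+1).
exists (fun u => h u + a * sin u ^+ n.+1); split; first exact: smooth_add.
  exists (M + `|a * n.+1%:R|) => u.
  have := is_derive_mul (is_derive_cst a u 1) (is_derive_sinX n u).
  rewrite mul0r add0r => da.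
  rewrite (derive1_val (is_derive_add (smooth_is_derive u sh) da)).
  rewrite (le_trans (ler_normD _ _)) // lerD // !mulrA -mulrA normrM.
  rewrite ler_piMr // normrM normrX mulr_ile1 // ?exprn_ile1 //.
  - exact: cos_max.
  - exact: sin_max.
move=> k kn; rewrite (derive1nD _ sh sa) (derive1n_mul_sinX (@smooth_cst R a) kn).
move: kn; rewrite leq_eqVlt => /predU1P[->|]; last first.
  by rewrite ltnS => kn; rewrite ltn_eqF ?ltnS // addr0 hc.
by rewrite eqxx /cst mulrC divfK ?subrKC //.
Qed.

End JetInterpolation.

(** * From covariance to the algebraic condition *)

Section Converse.
Variable R : realType.

Definition var_index (i : var) : nat :=
  match i with X k | Y k | W k => k end.

Lemma var_index_bounded (p : dpoly R) : exists n : nat,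
  forall m i, m \in msupp p -> i \in finsupp m -> (var_index i <= n)%N.
Proof.
exists (\max_(m <- msupp p) \max_(i <- finsupp m) var_index i)%N => m i mp im.
apply: (@leq_trans (\max_(j <- finsupp m) var_index j)%N).
  by apply: (@leq_bigmax_seq _ _ xpredT var_index).
have := @leq_bigmax_seq _ (enum_fset (msupp p)) xpredT
  (fun m : {cmonom var} => \max_(j <- finsupp m) var_index j)%N m mp isT.
by [].
Qed.

(** Covariance along the path id + t eta, for small t, differentiated at t = 0
and at the point u = 0. *)
Lemma Vgeo_phi_geo_hat0 (v : dpoly R) : Vgeo v -> phi_geo_hat v = 0.
Proof.
move=> [vM vcov]; apply: peval_inj => c.
have [n nP] := var_index_bounded (phi_geo_hat v).
have [eta [seta [M etaM] etac]] := jet_interpolation n (fun k => c (W k)).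
have [sigma [ss _ sigmac]] := jet_interpolation n (fun k => c (X k)).
have [Gamma [sG _ Gammac]] := jet_interpolation n (fun k => c (Y k) / 2).
pose d := curve 1 eta Gamma sigma.
have slope0 u : slope 1 eta 0 u != 0 by rewrite /slope mul0r addr0 oner_eq0.
have -> : peval c (phi_geo_hat v) = peval (d 0 0) (phi_geo_hat v).
  apply: eq_peval => m i mp im; have := nP m i mp im.
  case: i {im} => k /= kn.
  - rewrite /d (@curve0_weight _ _ _ _ _ _ _ _ 0 (X k)) ?oner_eq0 //.
    by rewrite exp1rz mul1r /= sigmac.
  - rewrite /d (@curve0_weight _ _ _ _ _ _ _ _ 0 (Y k)) ?oner_eq0 //.
    rewrite exp1rz mul1r /= Gammac //.
    by rewrite mulrC divfK ?pnatr_eq0.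
  - by rewrite /d curve0_W // etac.
rewrite phi_geo_hatE.
apply: etrans (pevalD _ _ _) _.
apply: etrans (congr1 (fun z => _ + z) (pevalN _ _)) _.
apply: etrans (congr1 (fun z => _ - z) (peval_w1 _ _ _ _ _ _ _)) _.
apply/eqP; rewrite subr_eq0; apply/eqP.
pose Y0 := Upsilon Gamma sigma v 0.
have dc := is_derive_curve_t seta sG ss vM 0 slope0.
rewrite -(derive1_val dc).
have M0 : 0 < M + 1.
  by rewrite ltr_wpDl // (le_trans (normr_ge0 _) (etaM 0)).
have small : \forall t \near (0 : R), `|t| <= 2^-1 / (M + 1).
  have e0 : 0 < 2^-1 / (M + 1) by rewrite divr_gt0 // invr_gt0 ltr0n.
  exact (nbhs0_le (V := R^o) e0).
have near_eq : \forall t \near (0 : R),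
    slope 1 eta t 0 * Y0 = peval (d t 0) v.
  near=> t.
  pose f u := 1 * u + t * eta u.
  have df (u : R) : is_derive u 1 f (slope 1 eta t u).
    have := is_derive_add (is_derive_mul (is_derive_cst (1 : R) u 1) (is_derive_id u 1))
      (is_derive_mul (is_derive_cst t u 1) (smooth_is_derive u seta)).
    by rewrite !mul0r !add0r mulr1.
  have sf : smooth f.
    apply: smooth_add; first exact: smooth_mul (@smooth_cst R 1) (@smooth_id R).
    exact: smooth_mul (@smooth_cst R t) seta.
  (* The slope is at least 1/2, as |t eta'| is at most 1/2 for small t. *)
  have f2 u : 2^-1 <= derive1 f u.
    rewrite (derive1_val (df u)) /slope.
    have tM : `|t * derive1 eta u| <= 2^-1.
      rewrite normrM; apply: (@le_trans _ _ (`|t| * (M + 1))).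
        by rewrite ler_wpM2l // ler_wpDr.
      by rewrite -ler_pdivlMr //; near: t; exact: small.
    have := ler_norm (- (t * derive1 eta u)); rewrite normrN => tN.
    by move: tM tN; lra.
  have [|phi phif] := derive_ge_diffeo sf _ f2; first by rewrite invr_gt0 ltr0n.
  rewrite (peval_curve_diffeo seta sG ss vM (phi := phi) 0); last exact: phif.
  have phi_id : homotopic phi id.
    by apply: homotopic_smooth; [exact: dfun_smooth|exact: smooth_id].
  rewrite -(vcov phi Gamma sigma phi_id sG ss) act_vecE; congr (_ * _).
  by rewrite (_ : dfun phi = f) ?(derive1_val (df 0)) //; apply/funext.
have dl : is_derive (0 : R) 1 (fun t => slope 1 eta t 0 * Y0) (derive1 eta 0 * Y0).
  have ds := is_derive_add (is_derive_cst (1 : R) (0 : R) 1) (is_derive_mul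
    (is_derive_id (0 : R) 1) (is_derive_cst (derive1 eta 0) (0 : R) 1)).
  apply: is_derive_eq (is_derive_mul ds (is_derive_cst Y0 (0 : R) 1)) _.
  by rewrite /cst; ring.
rewrite (derive1_val (near_eq_is_derive near_eq dl)).
rewrite (peval_curve0 seta sG ss vM) ?oner_eq0 // mul1r.
by rewrite /slope mul0r addr0 invr1 mul1r.
Unshelve. all: by end_near.
Qed.

End Converse.

Theorem theorem3p6 (R : realType) (v : dpoly R) (hv : calM v) :
  Vgeo v <-> phi_geo_hat v = 0%R.
Proof.
split=> [|v0]; first exact: Vgeo_phi_geo_hat0.
split=> // phi Gamma sigma _ sG ss; exact: phi_geo_hat0_covariant.
Qed.
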